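(* Let $\mathcal{P}$ be a polyhedron for which a coherent labelling exists. Suppose a new polyhedron $\mathcal{Q}$ is constructed from $\mathcal{P}$ by attaching a tetrahedron in any of the following ways: (i) with one face identified and no edge vanishing; (ii) with one face identified and only one edge vanishing; (iii) with one face identified and two edges and their common vertex vanishing; (iv) with one face identified and its three edges and its three vertices vanishing; (v) with two faces identified, their common edge vanishing, its opposite edge in the tetrahedron becoming a new edge (which gets a label), and the remaining four edges of the tetrahedron not vanishing. Then $\mathcal{Q}$ also has a coherent labelling.
   Context: Polyhedra here are solids in $\mathbb{R}^3$ bounded by finitely many polygonal faces, not necessarily convex. Each face $F$ is oriented by the outward normal, so its boundary edges are traversed anticlockwise as seen from outside. A labelling of all the edges by integers is coherent if, for each face $F$ with $n_F$ edges, there is a choice of starting edge such that the successive labels read anticlockwise from that edge satisfy $a_1<a_2<\cdots<a_{n_F}$. Attaching a tetrahedron $T$ to $\mathcal{P}$ means forming $\mathcal{Q}=\mathcal{P}\cup T$, where $\mathcal{P}\cap T$ is exactly one triangular face of $\mathcal{P}$ that is also a face of $T$ (one face identified), or exactly the union of two triangular faces of $\mathcal{P}$ sharing an edge that are also two faces of $T$ (two faces identified). An edge or vertex of $\mathcal{P}$ vanishes if it is no longer an edge or vertex of $\mathcal{Q}$. In detail: (i) The identified face is replaced by the other three triangles of $T$; all edges of $\mathcal{P}$ remain, and three new edges to the new apex are added. (ii) Exactly one edge $b$ of the identified face vanishes: the face of $T$ other than the identified one that contains $b$ is coplanar with, and merges into, the other face $G$ of $\mathcal{P}$ containing $b$,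 so that in the boundary of the new face the edge $b$ is replaced by two of the three new edges of $T$. The other two triangles of $T$ become new faces. (iii) Two edges $a,b$ of the identified face, meeting at a vertex $v$, vanish together with $v$: $v$ is incident in $\mathcal{P}$ with exactly one further edge $y$, the edge of $T$ from $v$ to its apex is a straight extension of $y$ and forms with $y$ a single edge of $\mathcal{Q}$, and the triangles of $T$ containing $a$ and $b$ merge into the neighbouring faces of $\mathcal{P}$ across $a$ and $b$. The remaining triangle of $T$ becomes a new face. (iv) All three edges and all three vertices of the identified face vanish: each of its vertices is incident in $\mathcal{P}$ with exactly one further edge, these three edges are extended straight until they meet at the apex of $T$, and the three other triangles of $T$ merge into the three neighbouring faces of $\mathcal{P}$. (v) The two identified faces share an edge $b$, which becomes interior to $\mathcal{Q}$; the edge of $T$ opposite to $b$ is a new edge of $\mathcal{Q}$, the other two triangles of $T$ are new faces of $\mathcal{Q}$, and the other four edges of $T$, which are edges of $\mathcal{P}$, remain edges of $\mathcal{Q}$. *)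

(* Defs.v *)
From HB Require Import structures.
From mathcomp Require Import all_boot all_order all_algebra.
From mathcomp Require Import all_classical all_reals all_analysis.
Import Order.TTheory GRing.Theory Num.Theory numFieldNormedType.Exports.

Set Implicit Arguments.
Unset Strict Implicit.
Unset Printing Implicit Defensive.

Local Open Scope classical_set_scope.
Local Open Scope ring_scope.

Section Geometry.
Context {R : realType}.
Local Notation point := 'rV[R]_3.

Definition hull (s : seq point) : set point :=
  [set x | exists c : nat -> R,
     [/\ forall i, 0 <= c i,
         \sum_(i < size s) c i = 1 &
         x = \sum_(i < size s) c i *: s`_i]].

Definition segment (u v : point) : set point := hull [:: u; v].

Definition directions (s : seq point) : seq point :=
  [seq x - head 0 s | x <- behead s].

Definition affinely_independent (s : seq point) : Prop := free (directions s).

Definition plane (s : seq point) : set point :=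
  [set x | x - head 0 s \in <<directions s>>%VS].

(* Indices are taken modulo 3. *)
Definition cross (u v : point) : point :=
  \row_(k < 3) (u 0 (k + 1) * v 0 (k + 1 + 1) - u 0 (k + 1 + 1) * v 0 (k + 1)).

(* A polygon is given by the cyclic sequence of its vertices; a sequence and
   its rotations stand for the same polygon. *)
Definition cyc (f : seq point) : set (seq point) :=
  [set g | exists k, g = rot k f].

(* The directed edges (x, y) of f; the last vertex is followed by the first. *)
Definition arcs (f : seq point) : seq (point * point) := zip f (rot 1%N f).

Definition face_edges (f : seq point) : seq (set point) :=
  [seq segment a.1 a.2 | a <- arcs f].

Definition contour (f : seq point) : set point :=
  [set x | exists2 a, a \in arcs f & segment a.1 a.2 x].

(* By the Jordan curve theorem, for a simple planar polygon these are the
   points of its plane enclosed by its contour. *)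
Definition inside (f : seq point) : set point :=
  [set x | [/\ plane f x, ~ contour f x &
     bounded_set (connected_component (plane f `\` contour f) x)]].

Definition region (f : seq point) : set point := contour f `|` inside f.

(* Twice the vector area of the polygon: this normal points towards the side
   from which the vertices are seen in anticlockwise order. *)
Definition normal (f : seq point) : point := \sum_(a <- arcs f) cross a.1 a.2.

(* Straight angles are allowed: in a non-convex polyhedron two consecutive
   edges of a face may be collinear and still be distinct edges, because the
   faces on their other sides differ. *)
Record polygon (f : seq point) : Prop := {
  polygon_uniq : uniq f;
  polygon_planar : \dim <<directions f>>%VS = 2%N;
  polygon_simple : forall a b, a \in arcs f -> b \in arcs f -> a != b ->
    segment a.1 a.2 `&` segment b.1 b.2
      `<=` [set x | x \in [:: a.1; a.2] /\ x \in [:: b.1; b.2]] }.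

Definition outward (S : set point) (f : seq point) : Prop :=
  forall x, inside f x ->
    \forall e \near 0^'+, ~ S (x + e *: normal f) /\ S (x - e *: normal f).

Definition adjacent (F : set (seq point)) (u v : point) : Prop :=
  exists2 f, F f & (u, v) \in arcs f.

(* S is the solid, and F consists of the boundary cycles of its faces, read
   anticlockwise from outside from each possible starting vertex. *)
Record is_polyhedron (S : set point) (F : set (seq point)) : Prop := {
  solid_neq0 : S !=set0;
  solid_compact : compact S;
  solid_connected : connected S;
  faces_finite : finite_set F;
  faces_rot : forall f, F f -> cyc f `<=` F;
  faces_polygon : forall f, F f -> polygon f;
  solid_boundary : closure S `\` interior S = \bigcup_(f in F) region f;
  faces_outward : forall f, F f -> outward S f;
  faces_meet : forall f g, F f -> F g -> ~ cyc f g ->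
    region f `&` region g `<=`
      [set x | (x \in f /\ x \in g) \/
         exists u v, [/\ (u, v) \in arcs f, (v, u) \in arcs g &
                         segment u v x]];
  (* each edge lies on exactly two faces, which traverse it in opposite
     directions and are not coplanar *)
  edge_other : forall f u v, F f -> (u, v) \in arcs f -> adjacent F v u;
  edge_once : forall f g u v, F f -> F g ->
    (u, v) \in arcs f -> (u, v) \in arcs g -> cyc f g;
  edge_bent : forall f g u v, F f -> F g ->
    (u, v) \in arcs f -> (v, u) \in arcs g -> ~ [set` g] `<=` plane f;
  (* a vertex with only two edges would be interior to a straight edge *)
  vertex_degree : forall f v, F f -> v \in f -> exists x y z,
    [/\ uniq [:: x; y; z], adjacent F v x, adjacent F v y & adjacent F v z] }.

End Geometry.

Record polyhedron (R : realType) := Polyhedron {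
  solid : set 'rV[R]_3;
  faces : set (seq 'rV[R]_3);
  polyhedronP : is_polyhedron solid faces }.

Section Labelling.
Context {R : realType}.
Local Notation point := 'rV[R]_3.
Implicit Types P Q : polyhedron R.

Definition vertices P : set point :=
  [set v | exists2 f, faces P f & v \in f].

Definition edges P : set (set point) :=
  [set e | exists2 f, faces P f & e \in face_edges f].

(* Only the values of L on edges P matter. *)
Definition coherent P (L : set point -> int) : Prop :=
  forall f, faces P f ->
    exists k, sorted <%R (rot k [seq L e | e <- face_edges f]).

Definition has_coherent_labelling P : Prop := exists L, coherent P L.

Definition vanishing_vertices P Q : set point := vertices P `\` vertices Q.

(* An edge of P that is extended to a longer edge of Q does not vanish. *)
Definition vanishing_edges P Q : set (set point) :=
  [set e | edges P e /\ ~ exists2 e', edges Q e' & e `<=` e'].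

(* Q is the union of P and the tetrahedron with vertices T, which meet in C. *)
Definition glued P Q (T : seq point) (C : set point) : Prop :=
  [/\ size T = 4%N, affinely_independent T,
      solid P `&` hull T = C & solid Q = solid P `|` hull T].

Definition face_through P (t : point) (g : seq point) : Prop :=
  faces P g /\ plane g t.

(* The only edges of P at v are those to u and w and a further one, to x,
   which the edge of the tetrahedron from v to t extends straight. *)
Definition extended P Q (u v w x t : point) : Prop :=
  [/\ x \notin [:: u; w],
      forall z, adjacent (faces P) v z <-> z \in [:: u; w; x],
      segment x v `&` segment v t = [set v],
      segment x v `|` segment v t = segment x t &
      edges Q (segment x t)].

(* In the first four cases [:: u; v; w] is the identified face, anticlockwise,
   and t is the apex of the tetrahedron. A neighbouring face across the edge
   from u to v traverses it from v to u. *)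

Definition attach_no_edge_vanishing P Q : Prop :=
  exists u v w t : point,
  [/\ faces P [:: u; v; w],
      glued P Q [:: u; v; w; t] (hull [:: u; v; w]),
      vanishing_edges P Q = set0 &
      faces Q = faces P `\` cyc [:: u; v; w]
        `|` (cyc [:: u; v; t] `|` cyc [:: v; w; t] `|` cyc [:: w; u; t])].

Definition attach_one_edge_vanishing P Q : Prop :=
  exists (u v w t : point) (s : seq point),
  [/\ faces P [:: u; v; w],
      face_through P t [:: v, u & s],
      glued P Q [:: u; v; w; t] (hull [:: u; v; w]),
      vanishing_edges P Q = [set segment u v] &
      faces Q = faces P `\` (cyc [:: u; v; w] `|` cyc [:: v, u & s])
        `|` (cyc [:: v, t, u & s]
             `|` cyc [:: v; w; t] `|` cyc [:: w; u; t])].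

Definition attach_two_edges_vanishing P Q : Prop :=
  exists (u v w t x : point) (s1 s2 : seq point),
  [/\ [/\ faces P [:: u; v; w],
          face_through P t [:: x, v, u & s1] &
          face_through P t [:: w, v, x & s2]],
      extended P Q u v w x t,
      glued P Q [:: u; v; w; t] (hull [:: u; v; w]),
      vanishing_edges P Q = [set segment u v; segment v w] /\
        vanishing_vertices P Q = [set v] &
      faces Q = faces P `\` (cyc [:: u; v; w]
                 `|` cyc [:: x, v, u & s1] `|` cyc [:: w, v, x & s2])
        `|` (cyc [:: x, t, u & s1] `|` cyc [:: w, t, x & s2]
             `|` cyc [:: w; u; t])].

Definition attach_three_edges_vanishing P Q : Prop :=
  exists (u v w t xu xv xw : point) (s1 s2 s3 : seq point),
  [/\ [/\ faces P [:: u; v; w],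
          face_through P t [:: xv, v, u, xu & s1],
          face_through P t [:: xw, w, v, xv & s2] &
          face_through P t [:: xu, u, w, xw & s3]],
      [/\ extended P Q w u v xu t, extended P Q u v w xv t &
          extended P Q v w u xw t],
      glued P Q [:: u; v; w; t] (hull [:: u; v; w]),
      vanishing_edges P Q = [set segment u v; segment v w; segment w u] /\
        vanishing_vertices P Q = [set u; v; w] &
      faces Q = faces P `\` (cyc [:: u; v; w]
                 `|` cyc [:: xv, v, u, xu & s1]
                 `|` cyc [:: xw, w, v, xv & s2]
                 `|` cyc [:: xu, u, w, xw & s3])
        `|` (cyc [:: xv, t, xu & s1] `|` cyc [:: xw, t, xv & s2]
             `|` cyc [:: xu, t, xw & s3])].

(* The identified faces are [:: p; q; r] and [:: q; p; s]. *)
Definition attach_two_faces P Q : Prop :=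
  exists p q r s : point,
  [/\ faces P [:: p; q; r] /\ faces P [:: q; p; s],
      glued P Q [:: p; q; r; s] (hull [:: p; q; r] `|` hull [:: q; p; s]),
      vanishing_edges P Q = [set segment p q],
      ~ edges P (segment r s) /\ edges Q (segment r s) &
      faces Q = faces P `\` (cyc [:: p; q; r] `|` cyc [:: q; p; s])
        `|` (cyc [:: r; p; s] `|` cyc [:: s; q; r])].

End Labelling.

(* Main.v *)
Require Import Defs.
From mathcomp Require Import all_boot all_order all_algebra.
From mathcomp Require Import all_classical all_reals all_analysis.
From mathcomp Require Import zify ring lra.
Import Order.TTheory GRing.Theory Num.Theory numFieldNormedType.Exports.

Set Implicit Arguments.
Unset Strict Implicit.
Unset Printing Implicit Defensive.

(** A label matters only through the cyclic order of the labels around each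
    face.  Multiply the labels of P by 4: an old edge may then be moved freely
    inside the interval [4 l, 4 l + 3] determined by its old label l, and more
    generally an edge of a face may be replaced by any increasing run of edges
    with labels in that interval, without disturbing the face
    ([csorted_refine_head]).  It is therefore enough to label the new edges
    inside such intervals so that the new faces come out cyclically increasing.

    With one face uvw identified, let a, b, c be the labels of uv, vw, wu; they
    are in cyclic order.  Write x+ for a label immediately after x.  The edges
    ut, vt, wt receive
    - c+, a+, b+ if no edge vanishes;
    - a+, a, b+ if uv vanishes: its label is split between vt and tu;
    - a and b, for ut and wt, if uv and vw vanish, the extended edge keeping its
      label: the last triangle then has labels c, a, b.
    If all three edges vanish, the three extended edges keep their labels, and
    each merged face just loses one label.

    With two faces identified, let the labels be e, b, c around pqr and e, d, f
    around qps.  The edge rs needs a label g such that both (c, d, g) and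
    (f, b, g) are in cyclic order.  The only obstruction is a coincidence of
    labels, c = d or b = f, so d and f are first moved up inside their
    intervals; then a label immediately after b or d will do
    ([cyc3_opposite]).

    Some geometry ensures that the new edges really are new and distinct, since
    labels are attached to segments as sets of points.  By affine independence
    of the vertices of the tetrahedron, the apex t is not in the identified
    face ([vertex_notin_hull]), hence not in the solid P, hence on no edge of P
    ([edges_avoid_apex]). *)

(** * Cyclically increasing sequences of labels *)

Lemma rot_zip (S T : Type) k (s : seq S) (t : seq T) :
  size s = size t -> rot k (zip s t) = zip (rot k s) (rot k t).
Proof.
move=> eq_st; rewrite /rot zip_cat ?size_drop ?eq_st //.
congr (_ ++ _).
  by elim: k s t eq_st => [|k IH] [|x s] [|y t] //= [/IH].
by elim: k s t eq_st => [|k IH] [|x s] [|y t] //= [/IH ->].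
Qed.

Lemma all2_rot (S T : Type) (r : S -> T -> bool) k s t :
  all2 r s t -> all2 r (rot k s) (rot k t).
Proof.
rewrite !all2E !size_rot => /andP[/eqP eq_st]; rewrite eq_st eqxx /=.
by rewrite -rot_zip // /rot all_cat andbC -all_cat cat_take_drop.
Qed.

Section CyclicallySorted.
Local Open Scope ring_scope.

(** Some rotation of the sequence is strictly increasing, that is, its entries
    are distinct and read in their cyclic order. *)
Definition csorted (l : seq int) : Prop := exists k, sorted <%R (rot k l).

Lemma csorted_rot k l : csorted l -> csorted (rot k l).
Proof.
case=> j lj; exists (rot_add (rot k l) (size (rot k l) - k) j).
by rewrite -rot_rot_add -/(rotr k _) rotK.
Qed.

(** The three integers are distinct and in cyclic order. *)
Definition cyc3 (a b c : int) : bool :=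
  [|| a < b < c, b < c < a | c < a < b].

Lemma csorted3 a b c : csorted [:: a; b; c] <-> cyc3 a b c.
Proof.
split=> [[[|[|[|k]]]]|]; rewrite /cyc3.
- by rewrite /= andbT => ->.
- by rewrite /= andbT => ->; rewrite orbT.
- by rewrite /= andbT => ->; rewrite !orbT.
- by rewrite rot_oversize // /= andbT => ->.
by case/or3P=> h; [exists 0%N | exists 1%N | exists 2%N]; rewrite /= andbT.
Qed.

(** The label of the edge rs opposite to the common edge of the identified
    faces.  Here e, b, c are the labels of pq, qr, rp, and e, d, f those of
    qp, ps, sq.  The shifts by 2 separate d from c and f from b. *)
Lemma cyc3_opposite (b c d e f : int) : cyc3 e b c -> cyc3 e d f ->
  exists g, cyc3 (4 * c) (4 * d + 2) g && cyc3 (4 * f + 2) (4 * b) g.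
Proof.
rewrite /cyc3 => cyc_bc cyc_df.
suff [] : (cyc3 (4 * c) (4 * d + 2) (4 * b + 1) &&
           cyc3 (4 * f + 2) (4 * b) (4 * b + 1))
       \/ (cyc3 (4 * c) (4 * d + 2) (4 * d + 3) &&
           cyc3 (4 * f + 2) (4 * b) (4 * d + 3)).
- by exists (4 * b + 1).
- by exists (4 * d + 3).
by rewrite /cyc3; lia.
Qed.

Variables (T : Type) (L L' : T -> int).

(** The label of e' lies in the interval allotted to the old label of e. *)
Definition refines (e e' : T) : bool := 4 * L e <= L' e' < 4 * L e + 4.

(** The edges b, in this order, may stand in place of e on a face. *)
Definition refined (e : T) (b : seq T) : bool :=
  sorted <%R [seq L' e' | e' <- b] && all (refines e) b.

Lemma refines4 e : L' e = 4 * L e -> refines e e.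
Proof. by rewrite /refines => ->; lia. Qed.

Lemma sorted_flatten es bs : all2 refined es bs ->
  sorted <%R [seq L e | e <- es] ->
  sorted <%R [seq L' e | e <- flatten bs].
Proof.
rewrite !(sorted_pairwise lt_trans); elim: es bs => [|e es IH] [|b bs] //=.
case/andP=> /andP[sb rb] rbs /andP[lt_e /(IH _ rbs) pbs].
rewrite map_cat pairwise_cat pbs -(sorted_pairwise lt_trans) sb andbT /= andbT.
have {pbs} le_bs : all (fun e' => 4 * L e + 4 <= L' e') (flatten bs).
  elim: es bs {IH pbs} rbs lt_e => [|e1 es IH] [|b1 bs] //=.
  case/andP=> /andP[_ rb1] rbs /andP[lt_e1 lt_e].
  rewrite all_cat {}IH // andbT; apply: sub_all rb1 => e2.
  by rewrite /refines => /andP[? _]; lia.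
rewrite /allrel all_map; apply: sub_all rb => e1 /andP[_ h1] /=.
by rewrite all_map; apply: sub_all le_bs => e2 /= h2; lia.
Qed.

Lemma csorted_flatten es bs : all2 refined es bs ->
  csorted [seq L e | e <- es] -> csorted [seq L' e | e <- flatten bs].
Proof.
move=> r_es [k]; rewrite -map_rot => /(sorted_flatten (all2_rot k r_es)) sk.
exists (size (flatten (take k bs))); move: sk.
rewrite -map_rot -{3}(cat_take_drop k bs) flatten_cat rot_size_cat.
by rewrite -flatten_cat.
Qed.

(** A face keeps its cyclic order when the edges es are replaced by the blocks
    bs while the others only move inside their intervals. *)
Lemma csorted_refine_head es bs rest : all2 refined es bs ->
  all (fun e => refines e e) rest ->
  csorted [seq L e | e <- es ++ rest] ->
  csorted [seq L' e | e <- flatten bs ++ rest].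
Proof.
move=> r_es r_rest.
have -> : flatten bs ++ rest = flatten (bs ++ [seq [:: e] | e <- rest]).
  by rewrite flatten_cat flatten_map1 map_id.
apply: csorted_flatten; move: r_es; rewrite !all2E !size_cat size_map eqn_add2r.
case/andP=> /eqP eq_size all_es; rewrite zip_cat // all_cat all_es eq_size eqxx.
by elim: rest r_rest => //= e rest IH /andP[re /IH ->]; rewrite /refined /= re.
Qed.

End CyclicallySorted.

(** * Segments and affinely independent points *)

Section Geometry.
Local Open Scope classical_set_scope.
Local Open Scope ring_scope.
Variable R : realType.
Local Notation point := 'rV[R]_3.
Implicit Types (u v w x y z : point) (f g s T : seq point) (P Q : polyhedron R).

Lemma segmentP u v x :
  segment u v x <-> exists2 a, 0 <= a <= 1 & x = a *: u + (1 - a) *: v.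
Proof.
split=> [[c [c_ge0]]|[a /andP[a_ge0 a_le1] ->]].
  rewrite /= !big_ord_recl !big_ord0 /= !addr0 => sum_c ->.
  have := c_ge0 0%N; have := c_ge0 1%N; exists (c 0%N); first by lra.
  by congr (_ + _ *: _); rewrite -sum_c addrAC subrr add0r.
exists (fun i => if i is 0%N then a else 1 - a).
split; last by rewrite /= !big_ord_recl !big_ord0 addr0.
- by case=> // i; lra.
- by rewrite /= !big_ord_recl !big_ord0 addr0 addrCA subrr addr0.
Qed.

Lemma segmentC u v : segment u v = segment v u.
Proof.
suff sub x y : segment x y `<=` segment y x by apply/seteqP; split; exact: sub.
move=> z /segmentP[a a01 ->]; apply/segmentP; exists (1 - a); first by lra.
by rewrite subKr addrC.
Qed.

Lemma mem_segmentr u v : segment u v v.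
Proof.
apply/segmentP; exists 0; first by rewrite lexx ler01.
by rewrite scale0r subr0 scale1r add0r.
Qed.

Lemma mem_segmentl u v : segment u v u.
Proof. by rewrite segmentC; exact: mem_segmentr. Qed.

(** For two points u and v of the segment from x to t, the segments from them
    to t are nested. *)
Lemma segment_total u v x t : segment x t u -> segment x t v ->
  segment v t u \/ segment u t v.
Proof.
suff key a b : 0 <= a <= b -> b <= 1 ->
    segment (b *: x + (1 - b) *: t) t (a *: x + (1 - a) *: t).
  move=> /segmentP[a /andP[a0 a1] ->] /segmentP[b /andP[b0 b1] ->].
  by case: (leP a b) => [ab|/ltW ba]; [left|right]; apply: key; rewrite ?a0 ?b0.
case/andP=> a_ge0; rewrite le_eqVlt => /predU1P[-> _|lt_ab _].
  exact: mem_segmentl.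
have b_gt0 : 0 < b by exact: le_lt_trans lt_ab.
apply/segmentP; exists (a / b).
  by rewrite divr_ge0 ?(ltW b_gt0) //= ler_pdivrMr // mul1r ltW.
rewrite scalerDr !scalerA -addrA -scalerDl mulrBr mulr1 divfK ?gt_eqF //.
by congr (_ + _ *: _); lra.
Qed.

(** Affinely independent points satisfy no nontrivial linear relation whose
    coefficients sum to 0. *)
Lemma affine_relation T (c : nat -> R) : affinely_independent T ->
  \sum_(i < size T) c i = 0 -> \sum_(i < size T) c i *: T`_i = 0 ->
  forall i, (i < size T)%N -> c i = 0.
Proof.
case: T => [|t0 T] //= indep; rewrite !big_ord_recl /= => sum_c sum_cT.
have c_tail (i : 'I_(size T)) : c i.+1 = 0.
  move: indep; rewrite /affinely_independent /directions /= => indep.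
  pose X : (size T).-tuple point :=
    @Tuple _ _ [seq x - t0 | x <- T] (introT eqP (size_map _ _)).
  have /freeP indepX : free X by [].
  apply: (indepX (fun i => c i.+1)).
  under eq_bigr => j _ do rewrite (nth_map 0) // scalerBr.
  rewrite sumrB -scaler_suml -[X in _ - X *: _]opprK -[X in - - X]add0r.
  move/eqP: sum_c; rewrite addr_eq0 => /eqP c0.
  by rewrite add0r scaleNr opprK -c0 addrC.
case=> [_|i]; last by rewrite ltnS => lt_i; exact: (c_tail (Ordinal lt_i)).
by move: sum_c; rewrite big1 ?addr0 // => i _; exact: c_tail.
Qed.

Lemma vertex_notin_hull T i (js : seq nat) : affinely_independent T ->
  (i < size T)%N -> all (fun j => j < size T)%N js -> i \notin js ->
  ~ hull [seq T`_j | j <- js] T`_i.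
Proof.
move=> indep lt_i lt_js i_js [c [_]]; rewrite size_map => sum_c T_i.
(* The convex combination minus T_i, as a relation between all points of T. *)
pose d n :=
  \sum_(k < size js) (if nth 0%N js k == n then c k else 0) - (n == i)%:R.
have lt_nth (k : 'I_(size js)) : (nth 0%N js k < size T)%N.
  by apply: (allP lt_js); rewrite mem_nth.
have sum_d (V : lmodType R) (f : nat -> V) : \sum_(n < size T) d n *: f n =
    \sum_(k < size js) c k *: f (nth 0%N js k) - f i.
  under eq_bigr => n _ do rewrite scalerBl scaler_suml.
  rewrite sumrB exchange_big /=; congr (_ - _).
    apply: eq_bigr => k _; rewrite (bigD1 (Ordinal (lt_nth k))) //= eqxx.
    rewrite big1 ?addr0 // => n /negPf; rewrite -val_eqE /= eq_sym => ->.
    by rewrite scale0r.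
  rewrite (bigD1 (Ordinal lt_i)) //= eqxx scale1r big1 ?addr0 // => n /negPf.
  by rewrite -val_eqE /= => ->; rewrite scale0r.
have /(_ i lt_i)/eqP : forall n, (n < size T)%N -> d n = 0.
  apply: affine_relation => //.
    have := sum_d R^o (fun=> 1); rewrite -[X in X = _]/(\sum_(n < _) d n * 1).
    under eq_bigr do rewrite mulr1.
    move=> ->; rewrite -[X in X - _]/(\sum_(n < _) c n * 1).
    by under eq_bigr do rewrite mulr1; rewrite sum_c subrr.
  rewrite sum_d [X in _ - X]T_i; apply/eqP; rewrite subr_eq0; apply/eqP.
  by apply: eq_bigr => k _; rewrite (nth_map 0%N).
rewrite /d big1 ?eqxx ?sub0r ?oppr_eq0 ?oner_eq0 // => k _.
by case: eqP => // eq_i; case/negP: i_js; rewrite -eq_i mem_nth.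
Qed.

(** * Edges and labels of polyhedra *)

Lemma face_edges_cons x s : face_edges (x :: s) = pairmap segment x (rcons s x).
Proof.
rewrite /face_edges /arcs rot1_cons; move: {2 4}x => y.
by elim: s x => //= z s IH x; rewrite IH.
Qed.

Lemma face_edges_rot k f : face_edges (rot k f) = rot k (face_edges f).
Proof. by rewrite /face_edges /arcs rot_rot -rot_zip ?size_rot // map_rot. Qed.

Lemma csorted_cyc (L : set point -> int) f g : cyc f g ->
  csorted [seq L e | e <- face_edges f] ->
  csorted [seq L e | e <- face_edges g].
Proof.
by case=> k ->; rewrite face_edges_rot map_rot; exact: csorted_rot.
Qed.

Lemma edge_sub_solid P e : edges P e -> e `<=` solid P.
Proof.
case=> f Ff /mapP[a fa ->] x ax; have PP := polyhedronP P.
have : closure (solid P) x.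
  suff [] : (closure (solid P) `\` interior (solid P)) x by [].
  by rewrite (solid_boundary PP); exists f => //; left; exists a.
suff /closure_id <- : closed (solid P) by [].
by apply: compact_closed (solid_compact PP); exact: norm_hausdorff.
Qed.

Lemma edges_avoid_apex P Q u v w t :
  glued P Q [:: u; v; w; t] (hull [:: u; v; w]) ->
  forall e, edges P e -> ~ e t.
Proof.
move=> [_ indep meet _] e Pe et.
apply: (@vertex_notin_hull _ 3 [:: 0; 1; 2]%N indep) => //=.
rewrite -meet; split; first exact: edge_sub_solid Pe _ et.
exists (fun i => (i == 3)%:R); split; rewrite ?ler0n //=;
  rewrite !big_ord_recl big_ord0 /=.
  by rewrite !add0r addr0.
by rewrite !scale0r !add0r scale1r addr0.
Qed.


(** N contains the faces of Q that are not faces of P. *)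
Lemma coherent_glue P Q (L L' : set point -> int) (N : set (seq point)) :
  coherent P L -> (forall e, edges P e -> refines L L' e e) ->
  faces Q `<=` faces P `|` N ->
  (forall f, N f -> csorted [seq L' e | e <- face_edges f]) ->
  coherent Q L'.
Proof.
move=> cohL refL subQ cohN f /subQ[Ff|/cohN //].
have /= := @csorted_refine_head _ L L' [::] [::] (face_edges f) isT.
apply; last exact: cohL.
by apply/allP => e fe; apply: refL; exists f.
Qed.

(** Three distinct segments outside E can be labelled at will. *)
Lemma extend3 (E : set (set point)) (L : set point -> int) k1 k2 k3 a1 a2 a3 :
  [/\ k1 <> k2, k1 <> k3 & k2 <> k3] -> ~ E k1 -> ~ E k2 -> ~ E k3 ->
  exists L' : set point -> int,
    [/\ L' k1 = a1, L' k2 = a2, L' k3 = a3 & forall e, E e -> L' e = L e].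
Proof.
move=> [/eqP/negPf k12 /eqP/negPf k13 /eqP/negPf k23] nE1 nE2 nE3.
exists [eta L with k1 |-> a1, k2 |-> a2, k3 |-> a3] => /=.
rewrite !eqxx (eq_sym k2) k12 ![k3 == _]eq_sym k13 k23; split=> // e Ee.
case: eqP => [ek|_]; first by case: nE1; rewrite -ek.
case: eqP => [ek|_]; first by case: nE2; rewrite -ek.
by case: eqP => [ek|_] //; case: nE3; rewrite -ek.
Qed.

Lemma apex_segments_neq T i j k : affinely_independent T ->
  (i < size T)%N -> (j < size T)%N -> (k < size T)%N -> i \notin [:: j; k] ->
  segment T`_i T`_k <> segment T`_j T`_k.
Proof.
move=> indep lt_i lt_j lt_k i_jk eq_seg.
apply: (@vertex_notin_hull _ i [:: j; k] indep) => //=.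
  by rewrite lt_j lt_k.
by rewrite -/(segment _ _) -eq_seg; exact: mem_segmentl.
Qed.

(** * The five ways of attaching a tetrahedron *)

Variables (P Q : polyhedron R) (L : set point -> int).
Hypothesis cohL : coherent P L.

Let csortedL x s : faces P (x :: s) ->
  csorted [seq L e | e <- pairmap segment x (rcons s x)].
Proof. by move=> Fs; rewrite -face_edges_cons; exact: cohL. Qed.

Let edgeP x s e : faces P (x :: s) ->
  e \in pairmap segment x (rcons s x) -> edges P e.
Proof. by move=> Fs; rewrite -face_edges_cons; exists (x :: s). Qed.

Lemma triangle_labels x y z : faces P [:: x; y; z] ->
  [/\ edges P (segment x y), edges P (segment y z), edges P (segment z x) &
      cyc3 (L (segment x y)) (L (segment y z)) (L (segment z x))].
Proof.
move=> Fxyz; have /csorted3 cyc_xyz := csortedL Fxyz.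
by split=> //; apply: (edgeP Fxyz); rewrite /= !inE eqxx ?orbT.
Qed.

Lemma apex_labels u v w t a1 a2 a3 :
  glued P Q [:: u; v; w; t] (hull [:: u; v; w]) ->
  exists L' : set point -> int,
    [/\ L' (segment u t) = a1, L' (segment v t) = a2, L' (segment w t) = a3 &
        forall e, edges P e -> L' e = 4 * L e].
Proof.
move=> glue; have avoid := edges_avoid_apex glue; have [_ indep _ _] := glue.
have nP x : ~ edges P (segment x t).
  by move=> /avoid; apply; exact: mem_segmentr.
have neqs := apex_segments_neq indep.
apply: (@extend3 (edges P) (fun e => 4 * L e)) => //.
split; [exact: (neqs 0 1 3)%N | exact: (neqs 0 2 3)%N |].
exact: (neqs 1 2 3)%N.
Qed.

Lemma coherent_no_edge_vanishing :
  attach_no_edge_vanishing P Q -> has_coherent_labelling Q.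
Proof.
case=> u [v [w [t [Fuvw glue _ defQ]]]].
have := triangle_labels Fuvw.
set a := segment u v; set b := segment v w; set c := segment w u.
case=> Pa Pb Pc cyc_abc.
have [L' [Lu Lv Lw LP]] :=
  apex_labels (4 * L c + 1) (4 * L a + 1) (4 * L b + 1) glue.
exists L'; apply: (coherent_glue cohL) => [e Pe||].
- exact/refines4/LP.
- by rewrite defQ => f [[Ff _]|]; [left|right; eassumption].
move: cyc_abc; rewrite /cyc3 => cyc_abc.
by move=> f [[|]|] /csorted_cyc; apply;
  rewrite face_edges_cons /= -/a -/b -/c !(segmentC t) ?Lu ?Lv ?Lw !LP //;
  apply/csorted3; rewrite /cyc3; lia.
Qed.

(** The face obtained when a triangle of the tetrahedron merges into a
    neighbouring face of P: rest is the part of its boundary that does not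
    change. *)
Lemma csorted_merge L' es bs rest : (forall e, edges P e -> L' e = 4 * L e) ->
  (forall e, e \in rest -> edges P e) -> all2 (refined L L') es bs ->
  csorted [seq L e | e <- es ++ rest] ->
  csorted [seq L' e | e <- flatten bs ++ rest].
Proof.
move=> LP Prest ref; apply: csorted_refine_head ref _.
by apply/allP => e e_rest; apply/refines4/LP/Prest.
Qed.

Lemma coherent_one_edge_vanishing :
  attach_one_edge_vanishing P Q -> has_coherent_labelling Q.
Proof.
case=> u [v [w [t [s [Fuvw [Fvus _] glue _ defQ]]]]].
have := triangle_labels Fuvw.
set a := segment u v; set b := segment v w; set c := segment w u.
case=> Pa Pb Pc cyc_abc.
have [L' [Lu Lv Lw LP]] :=
  apex_labels (4 * L a + 1) (4 * L a) (4 * L b + 1) glue.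
exists L'; apply: (coherent_glue cohL) => [e Pe||].
- exact/refines4/LP.
- by rewrite defQ => f [[Ff _]|]; [left|right; eassumption].
move: cyc_abc; rewrite /cyc3 => cyc_abc.
move=> f [[|]|] /csorted_cyc; apply;
  rewrite face_edges_cons; last 2 first.
- rewrite /= -/b !(segmentC t) Lv Lw LP //; apply/csorted3.
  by rewrite /cyc3; lia.
- rewrite /= -/c !(segmentC t) Lu Lw LP //; apply/csorted3.
  by rewrite /cyc3; lia.
apply: (@csorted_merge L' [:: segment v u]
  [:: [:: segment v t; segment t u]] _ LP _ _ (csortedL Fvus)).
  by move=> e e_rest; apply: (edgeP Fvus); rewrite /= inE e_rest orbT.
rewrite /= /refined /refines /= (segmentC t) (segmentC v u) -/a Lu Lv.
by lia.
Qed.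

Lemma coherent_two_edges_vanishing :
  attach_two_edges_vanishing P Q -> has_coherent_labelling Q.
Proof.
case=> u [v [w [t [x [s1 [s2 [[Fuvw [F1 _] [F2 _]] ext glue _ defQ]]]]]]].
have := triangle_labels Fuvw.
set a := segment u v; set b := segment v w; set c := segment w u.
case=> Pa Pb Pc cyc_abc.
have avoid := edges_avoid_apex glue; have [_ indep _ _] := glue.
have nP y : ~ edges P (segment y t).
  by move=> /avoid; apply; exact: mem_segmentr.
have v_xt : segment x t v.
  by case: ext => _ _ _ <- _; right; exact: mem_segmentl.
have notin := vertex_notin_hull indep.
have [|L' [Lu Lw Lx LP]] := @extend3 (edges P) (fun e => 4 * L e) (segment u t)
    (segment w t) (segment x t) (4 * L a) (4 * L b) (4 * L (segment x v)) _
    (nP _) (nP _) (nP _).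
  split=> eq_seg.
  - by apply: (apex_segments_neq indep (i := 0) (j := 2) (k := 3)) => //.
  - by apply: (notin 1 [:: 0; 3])%N => //; rewrite /= -/(segment _ _) eq_seg.
  - by apply: (notin 1 [:: 2; 3])%N => //; rewrite /= -/(segment _ _) eq_seg.
exists L'; apply: (coherent_glue cohL) => [e Pe||].
- exact/refines4/LP.
- by rewrite defQ => f [[Ff _]|]; [left|right; eassumption].
move=> f [[|]|] /csorted_cyc; apply; rewrite face_edges_cons.
- apply: (@csorted_merge L' [:: segment x v; segment v u]
    [:: [:: segment x t]; [:: segment t u]] _ LP _ _ (csortedL F1)).
    by move=> e e_rest; apply: (edgeP F1); rewrite /= !inE e_rest !orbT.
  rewrite /= /refined /refines /= (segmentC t) (segmentC v u) -/a Lu Lx.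
  by lia.
- apply: (@csorted_merge L' [:: segment w v; segment v x]
    [:: [:: segment w t]; [:: segment t x]] _ LP _ _ (csortedL F2)).
    by move=> e e_rest; apply: (edgeP F2); rewrite /= !inE e_rest !orbT.
  rewrite /= /refined /refines /= (segmentC t) (segmentC v x) (segmentC w v).
  rewrite -/b Lw Lx.
  by lia.
rewrite /= -/c !(segmentC t) Lu Lw LP //; apply/csorted3.
by move: cyc_abc; rewrite /cyc3; lia.
Qed.

Lemma coherent_three_edges_vanishing :
  attach_three_edges_vanishing P Q -> has_coherent_labelling Q.
Proof.
case=> u [v [w [t [xu [xv [xw [s1 [s2 [s3]]]]]]]]].
case=> [[_ [F1 _] [F2 _] [F3 _]] [extu extv extw] glue _ defQ].
have avoid := edges_avoid_apex glue; have [_ indep _ _] := glue.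
have nP y : ~ edges P (segment y t).
  by move=> /avoid; apply; exact: mem_segmentr.
have mem y z x y' : Defs.extended P Q y x z y' t -> segment y' t x.
  by case=> _ _ _ <- _; right; exact: mem_segmentl.
(* Two vertices of the face on one segment ending at t would be collinear with
   t, contrary to affine independence. *)
have neq i j x y : (i < 3)%N -> (j < 3)%N -> i != j ->
    segment x t [:: u; v; w; t]`_i -> segment y t [:: u; v; w; t]`_j ->
    segment x t <> segment y t.
  move=> lt_i lt_j ne_ij xi yj eq_xy; rewrite -eq_xy in yj.
  have lt3 k : (k < 3)%N -> (k < 4)%N by move/ltnW.
  have ne3 k : (k < 3)%N -> k != 3%N by move=> ltk; rewrite ltn_eqF.
  case: (segment_total xi yj).
    apply: (@vertex_notin_hull _ i [:: j; 3] indep (lt3 _ lt_i)) => /=.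
      by rewrite lt3.
    by rewrite !inE negb_or ne_ij ne3.
  apply: (@vertex_notin_hull _ j [:: i; 3] indep (lt3 _ lt_j)) => /=.
    by rewrite lt3.
  by rewrite !inE negb_or eq_sym ne_ij ne3.
have [|L' [Lu Lv Lw LP]] := @extend3 (edges P) (fun e => 4 * L e) (segment xu t)
    (segment xv t) (segment xw t) (4 * L (segment u xu)) (4 * L (segment v xv))
    (4 * L (segment w xw)) _ (nP _) (nP _) (nP _).
  move: (mem _ _ _ _ extu) (mem _ _ _ _ extv) (mem _ _ _ _ extw) => mu mv mw.
  by split; [exact: (neq 0 1)%N | exact: (neq 0 2)%N | exact: (neq 1 2)%N].
exists L'; apply: (coherent_glue cohL) => [e Pe||].
- exact/refines4/LP.
- by rewrite defQ => f [[Ff _]|]; [left|right; eassumption].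
(* The middle edge, whose label is dropped, becomes an empty block. *)
have face y yt z zt s : faces P [:: zt, z, y, yt & s] ->
    L' (segment yt t) = 4 * L (segment y yt) ->
    L' (segment zt t) = 4 * L (segment z zt) ->
    csorted [seq L' e | e <- face_edges [:: zt, t, yt & s]].
  move=> F Ly Lz; rewrite face_edges_cons.
  apply: (@csorted_merge L' [:: segment zt z; segment z y; segment y yt]
     [:: [:: segment zt t]; [::]; [:: segment t yt]] _ LP _ _ (csortedL F)).
    by move=> e e_rest; apply: (edgeP F); rewrite /= !inE e_rest !orbT.
  rewrite /= /refined /refines /= (segmentC t) (segmentC zt z) Ly Lz.
  by lia.
by move=> f [[|]|] /csorted_cyc; apply; apply: face; eassumption.
Qed.

Lemma coherent_two_faces : attach_two_faces P Q -> has_coherent_labelling Q.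
Proof.
case=> p [q [r [s [[Fpqr Fqps] [_ indep _ _] _ [nPrs _] defQ]]]].
have [_ Pb Pc cyc_bc] := triangle_labels Fpqr.
have [_ Pd Pf cyc_df] := triangle_labels Fqps.
move: (segmentC q p) cyc_df => ->; set e := segment p q in cyc_bc *.
move: Pb Pc Pd Pf cyc_bc.
set b := segment q r; set c := segment r p; set d := segment p s.
set f := segment s q => Pb Pc Pd Pf cyc_bc cyc_df.
have notin := vertex_notin_hull indep.
have nb : b \notin [:: d; f].
  rewrite !inE; apply/norP; split; apply/eqP => eq_seg.
    by apply: (notin 1 [:: 0; 3])%N => //;
      rewrite /= -/(segment _ _) -/d -eq_seg; exact: mem_segmentl.
  by apply: (notin 2 [:: 3; 1])%N => //;
      rewrite /= -/(segment _ _) -/f -eq_seg; exact: mem_segmentr.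
have nc : c \notin [:: d; f].
  rewrite !inE; apply/norP; split; apply/eqP => eq_seg.
    by apply: (notin 2 [:: 0; 3])%N => //;
      rewrite /= -/(segment _ _) -/d -eq_seg; exact: mem_segmentl.
  by apply: (notin 2 [:: 3; 1])%N => //;
      rewrite /= -/(segment _ _) -/f -eq_seg; exact: mem_segmentl.
pose L1 (k : set point) := 4 * L k + 2 * (k \in [:: d; f])%:Z.
have [g cyc_g] : exists g : int, cyc3 (L1 c) (L1 d) g && cyc3 (L1 f) (L1 b) g.
  rewrite /L1 (negPf nb) (negPf nc) !inE !eqxx orbT !mulr0 !mulr1 !addr0.
  exact: cyc3_opposite cyc_bc cyc_df.
have [L' [Lrs LP]] : exists L' : set point -> int,
    L' (segment r s) = g /\ forall k, edges P k -> L' k = L1 k.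
  exists [eta L1 with segment r s |-> g]; split=> [|k Pk] /=.
    by rewrite eqxx.
  by case: eqP => // k_rs; case: nPrs; rewrite -k_rs.
exists L'; apply: (coherent_glue cohL) => [x Px||].
- by rewrite /refines LP // /L1; case: (x \in _); lia.
- by rewrite defQ => h [[Fh _]|]; [left|right; eassumption].
have [cyc1 cyc2] := andP cyc_g.
move=> h [|] /csorted_cyc; apply; rewrite face_edges_cons /=; apply/csorted3.
  by rewrite -/c -/d (segmentC s r) Lrs !LP.
by rewrite -/b -/f Lrs !LP.
Qed.

End Geometry.

Theorem theorem4p1 (R : realType) (P Q : polyhedron R) :
  has_coherent_labelling P ->
  [\/ attach_no_edge_vanishing P Q,
      attach_one_edge_vanishing P Q,
      attach_two_edges_vanishing P Q |
      attach_three_edges_vanishing P Q \/ attach_two_faces P Q] ->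
  has_coherent_labelling Q.
Proof.
case=> L cohL [||| []].
- exact: coherent_no_edge_vanishing cohL.
- exact: coherent_one_edge_vanishing cohL.
- exact: coherent_two_edges_vanishing cohL.
- exact: coherent_three_edges_vanishing cohL.
- exact: coherent_two_faces cohL.
Qed.
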